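(* Let $\mathcal F$ be a $1$-dense union-closed family over $[n]$, and let $\mathcal G$ be the family of all inclusion-wise minimal members of $\mathcal F$. Then $\mathcal F$ has a closure root if and only if $\overline{\langle\mathcal G\rangle_{\mathcal F}}=\mathcal F$.
   Context: A family of subsets of $[n]$ is union-closed over $[n]$ if it contains $[n]$ and is closed under pairwise unions; the empty set is never a member of any family, and $2^{[n]}$ denotes all nonempty subsets of $[n]$. The closure of a union-closed $\mathcal H$ is $\overline{\mathcal H}=\{A\in 2^{[n]}:\ \mathcal H\cup\{A\}\text{ is union-closed}\}$; $\mathcal F$ is $1$-dense if $\mathcal F\ne 2^{[n]}$ and $\overline{\mathcal F}=2^{[n]}$. A union-closed family $\mathcal H$ is a closure root of $\mathcal F$ if $\overline{\mathcal H}=\mathcal F$. Relative subsets: for $A,B\in\mathcal F$, $A\subseteq_{\mathcal F}B$ means that $A=B$, or $B=[n]$, or there exists $C\in\mathcal F$ with $C\neq B$ and $A\cup C=B$. $\langle\mathcal G\rangle_{\mathcal F}=\{B\in\mathcal F:\ \exists A\in\mathcal G,\ A\subseteq_{\mathcal F}B\}$, and $\overline{\langle\mathcal G\rangle_{\mathcal F}}$ is its closure. *)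

(* Defs.v *)
From mathcomp Require Import all_boot.

Set Implicit Arguments.
Unset Strict Implicit.
Unset Printing Implicit Defensive.

Section Families.

Variable n : nat.
Implicit Types (A B : {set 'I_n}) (F G H : {set {set 'I_n}}).

Definition nonempty_subsets : {set {set 'I_n}} := [set A | A != set0].

(* The empty set is never a member of a family. *)
Definition union_closed F : bool :=
  [&& set0 \notin F, [set: 'I_n] \in F
    & [forall A in F, forall B in F, A :|: B \in F]].

Definition uc_closure H : {set {set 'I_n}} :=
  [set A in nonempty_subsets | union_closed (H :|: [set A])].

Definition one_dense F : Prop :=
  F <> nonempty_subsets /\ uc_closure F = nonempty_subsets.

Definition closure_root H F : Prop := union_closed H /\ uc_closure H = F.

(* Only meant for A and B in F. *)
Definition rel_subset F A B : bool :=
  [|| A == B, B == [set: 'I_n]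
    | [exists C in F, (C != B) && (A :|: C == B)]].

Definition rel_generated F G : {set {set 'I_n}} :=
  [set B in F | [exists A in G, rel_subset F A B]].

Definition minimal_members F : {set {set 'I_n}} :=
  [set A | minset (fun B => B \in F) A].

End Families.

(* Main.v *)
Require Import Defs.
From mathcomp Require Import all_boot.

(** A 1-dense family [F] is an up-set, so [F] always lies in the closure of the
    family [R] generated by its minimal members, and [R] is union-closed; hence
    [R] is a closure root as soon as its closure is [F].
    Conversely let [H] be a closure root and [A] a nonempty set outside [F].
    Some [X = A :|: B0] with [B0 \in H] is not in [H].  Let [B] be the largest
    member of [H] between [B0] and [X].  As [F] is the closure of [H], each
    member of [F] below [X] is comparable to [B]; adding a point of [X :\: B] to
    a member of [F] below [B] then shows that [B] is the only minimal member of
    [F] below [X].  So [X = A :|: B] is not in [R] although [B] is, and [A] is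
    not in the closure of [R]. *)

Section ClosureRoots.

Variable n : nat.
Implicit Types (A B C X Y M : {set 'I_n}) (F G H : {set {set 'I_n}}).

Lemma union_closedP F :
  reflect [/\ set0 \notin F, [set: 'I_n] \in F
            & forall A B, A \in F -> B \in F -> A :|: B \in F]
          (union_closed F).
Proof.
apply: (iffP and3P) => -[F0 FT FU]; split=> //.
  by move=> A B FA FB; exact: (forall_inP (forall_inP FU A FA)).
by apply/forall_inP => A FA; apply/forall_inP => B FB; exact: FU.
Qed.

(** The only unions in [H :|: [set A]] not already settled by [H] are the [A :|: B] with [B \in H];
    such a union is in [H] or equals [A]. *)
Lemma uc_closureP H A : union_closed H ->
  reflect (A != set0 /\ forall B, B \in H -> A :|: B \in H \/ B \subset A)
          (A \in uc_closure H).
Proof.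
move=> /union_closedP[H0 HT HU]; rewrite !inE.
apply: (iffP andP) => -[A0 HA]; split=> //.
  move=> B HB; have /union_closedP[_ _ /(_ A B)] := HA.
  rewrite !inE eqxx HB orbT => /(_ isT isT) /orP[|/eqP AB]; first by left.
  by right; apply/setUidPl.
apply/union_closedP; split.
- by rewrite !inE negb_or H0 eq_sym.
- by rewrite !inE HT.
have HAU B : B \in H -> (A :|: B \in H) || (A :|: B == A).
  by move=> /HA[-> //|/setUidPl->]; rewrite eqxx orbT.
move=> B C; rewrite !inE => /orP[HB|/eqP->] /orP[HC|/eqP->].
- by rewrite HU.
- by rewrite setUC HAU.
- exact: HAU.
- by rewrite setUid eqxx orbT.
Qed.

Lemma sub_uc_closure H : union_closed H -> H \subset uc_closure H.
Proof.
move=> ucH; apply/subsetP => A HA; apply/uc_closureP => //.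
have /union_closedP[H0 _ HU] := ucH.
by split=> [|B HB]; [apply: contraNneq H0 => <- | left; exact: HU].
Qed.

(** For [A] properly inside [B], density puts [B :\: A] in the closure of [F], and its union with
    [A] is [B]. *)
Lemma one_dense_upset F A B :
  union_closed F -> one_dense F -> A \in F -> A \subset B -> B \in F.
Proof.
move=> ucF [_ dF] FA sAB; have [<-//|neAB] := eqVneq A B.
have /union_closedP[F0 _ _] := ucF.
have D0 : B :\: A != set0.
  rewrite setD_eq0; apply: contra neAB => sBA.
  by rewrite eqEsubset sAB.
have : B :\: A \in uc_closure F by rewrite dF inE.
case/uc_closureP=> // _ /(_ A FA) [|sAD].
  by rewrite setUC -[A in A :|: _](setIidPr sAB) setID.
case/negP: F0; suff <- : A = set0 by [].
apply/setP => x; rewrite inE; apply/idP => Ax.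
by have := subsetP sAD x Ax; rewrite !inE Ax.
Qed.

Lemma minimal_membersP F M :
  reflect (M \in F /\ forall B, B \in F -> B \subset M -> B = M)
          (M \in minimal_members F).
Proof. by rewrite inE; exact: minsetP. Qed.

Section OneDense.

Variable F : {set {set 'I_n}}.
Hypotheses (ucF : union_closed F) (dF : one_dense F).

Local Notation R := (rel_generated F (minimal_members F)).

Lemma rel_generated_sub G : rel_generated F G \subset F.
Proof. by apply/subsetP => B; rewrite inE => /andP[]. Qed.

Lemma minimal_members_sub_generated : minimal_members F \subset R.
Proof.
apply/subsetP => M GM; have [FM _] := minimal_membersP _ _ GM.
by rewrite inE FM; apply/exists_inP; exists M; rewrite // /rel_subset eqxx.
Qed.

Lemma setT_rel_generated : [set: 'I_n] \in R.
Proof.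
have /union_closedP[_ FT _] := ucF.
have [M minM _] := minset_exists (P := fun B => B \in F) FT.
rewrite inE FT; apply/exists_inP; exists M; first by rewrite inE.
by rewrite /rel_subset eqxx orbT.
Qed.

(** With [X] in [R] this gives closure under unions; with [X] in [F] it puts [F] inside the closure
    of [R]. The generator below [B] is kept for [X :|: B], and only its complementing set
    changes. *)
Lemma rel_generatedU X B : X \in F -> B \in R -> X :|: B \in R \/ B \subset X.
Proof.
move=> FX; rewrite inE => /andP[FB /exists_inP[A GA]].
have /union_closedP[_ _ FU] := ucF.
have [->|neXB] := eqVneq B [set: 'I_n].
  by left; rewrite setUT setT_rel_generated.
have [sBX|nsBX] := boolP (B \subset X); first by right.
rewrite /rel_subset (negPf neXB) /= => AB; left.
rewrite inE FU //=; apply/exists_inP; exists A => //; apply/or3P/Or33/exists_inP.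
(* If [B] is itself the generator, [X] complements it, and [X] differs from [X :|: B] since [B] is
   not inside [X]. *)
have [eAB|neAB] := eqVneq A B.
  exists X => //; rewrite eAB setUC eqxx andbT.
  by apply: contraNneq nsBX => ->; exact: subsetUl.
move: AB; rewrite (negPf neAB) /= => /exists_inP[C FC /andP[neCB /eqP eB]].
have /subsetPn[a Ba nCa] : ~~ (B \subset C).
  by apply: contra neCB => sBC; rewrite eqEsubset sBC -eB subsetUr.
have Aa : a \in A by move: Ba; rewrite -eB inE (negPf nCa) orbF.
(* This set contains [C], so it is in the up-set [F]; the missing point [a] is restored by [A]. *)
exists ((X :|: B) :\ a).
  apply: one_dense_upset FC _ => //; rewrite subsetD1 nCa andbT.
  by rewrite -eB setUA subsetUr.
apply/andP; split.
  by apply/eqP => /setP/(_ a); rewrite !inE eqxx Ba orbT.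
apply/eqP/setP => y; rewrite !inE -eB !inE.
by have [->|] := eqVneq y a; rewrite ?Aa ?orbT //=; case: (y \in A); rewrite ?orbT.
Qed.

Lemma union_closed_rel_generated : union_closed R.
Proof.
have /union_closedP[F0 _ _] := ucF.
apply/union_closedP; split.
- exact: contra (subsetP (rel_generated_sub _) _) F0.
- exact: setT_rel_generated.
move=> A B RA RB; have FA := subsetP (rel_generated_sub _) _ RA.
by have [//|/setUidPl->] := rel_generatedU _ _ FA RB.
Qed.

Lemma sub_closure_rel_generated : F \subset uc_closure R.
Proof.
have /union_closedP[F0 _ _] := ucF.
apply/subsetP => X FX; apply/uc_closureP; first exact: union_closed_rel_generated.
by split=> [|B RB]; [apply: contraNneq F0 => <- | exact: rel_generatedU].
Qed.

(** Unless [B] lies in [Y], the union [Y :|: B] is a member of [H] inside [X], so it equals [B] by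
    maximality. *)
Lemma root_comparable H B X Y :
  closure_root H F -> maxset (fun C => (C \in H) && (C \subset X)) B ->
  Y \in F -> Y \subset X -> Y \subset B \/ B \subset Y.
Proof.
move=> [ucH eH] /maxsetP[/andP[HB sBX] maxB] FY sYX.
have : Y \in uc_closure H by rewrite eH.
case/uc_closureP=> // _ /(_ B HB) [HYB|]; last by right.
left; apply/setUidPr; apply: maxB; last exact: subsetUr.
by rewrite HYB subUset sYX.
Qed.

Lemma root_maxset_minimal H B X :
  closure_root H F -> maxset (fun C => (C \in H) && (C \subset X)) B ->
  B != X ->
  forall M, M \in F -> M \subset B -> M = B.
Proof.
move=> rootH maxB neBX M FM sMB; have cmp := root_comparable _ _ _ _ rootH maxB.
have /maxsetP[/andP[HB sBX] _] := maxB.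
have /subsetPn[x Xx nBx] : ~~ (X \subset B).
  by apply: contra neBX => sXB; rewrite eqEsubset sBX.
have FMx : x |: M \in F by apply: one_dense_upset FM (subsetUr _ _).
have sMxX : x |: M \subset X by rewrite subUset sub1set Xx (subset_trans sMB).
(* As [x] is outside [B], the set [x |: M] must contain [B], and then [M] already does. *)
case: (cmp _ FMx sMxX) => [|sBM].
  by rewrite subUset sub1set (negPf nBx).
apply/eqP; rewrite eqEsubset sMB; apply/subsetP => y By.
by have := subsetP sBM y By; rewrite !inE => /predU1P[eyx|//]; rewrite -eyx By in nBx.
Qed.

Lemma closure_rel_generated_sub H :
  closure_root H F -> uc_closure R \subset F.
Proof.
move=> rootH; have [ucH eH] := rootH; have /union_closedP[_ HT _] := ucH.
apply/subsetP => A /uc_closureP-/(_ union_closed_rel_generated)[A0 RA].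
have [//|nFA] := boolP (A \in F).
suff: A \in F by rewrite (negPf nFA).
(* No member of [H] lies inside [A], as [A] is outside the up-set [F]; so only the first alternative
   is possible. *)
rewrite -eH; apply/uc_closureP => //; split=> // B0 HB0; left.
set X := A :|: B0; have [//|nHX] := boolP (X \in H).
have FB0 : B0 \in F by rewrite -eH (subsetP (sub_uc_closure _ ucH)).
pose P C := (C \in H) && (C \subset X).
have [|B maxB sB0B] := maxset_exists (P := P) (C := B0).
  by rewrite /P HB0 subsetUr.
have /maxsetP[/andP[HB sBX] _] := maxB.
have neBX : B != X by apply: contraNneq nHX => <-.
have FB : B \in F := one_dense_upset _ _ _ ucF dF FB0 sB0B.
have minB := root_maxset_minimal _ _ _ rootH maxB neBX.
have cmp := root_comparable _ _ _ _ rootH maxB.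
have eX : A :|: B = X.
  by apply/eqP; rewrite eqEsubset subUset subsetUl sBX setUS.
have RB : B \in R.
  by apply: (subsetP minimal_members_sub_generated); apply/minimal_membersP.
case: (RA B RB) => [|sBA]; last first.
  by rewrite (one_dense_upset _ _ _ ucF dF FB sBA) in nFA.
rewrite eX inE => /andP[_ /exists_inP[M /minimal_membersP[FM minM] /or3P[]]].
- move=> /eqP eMX; rewrite eMX in minM.
  by rewrite (minM _ FB sBX) eqxx in neBX.
- by move=> /eqP eXT; rewrite eXT HT in nHX.
case/exists_inP=> C FC /andP[neCX /eqP eMC].
have sMX : M \subset X by rewrite -eMC subsetUl.
have sCX : C \subset X by rewrite -eMC subsetUr.
have eMB : M = B.
  by have [/(minB _ FM)//|/(minM _ FB)] := cmp _ FM sMX.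
(* Since [C] is comparable to [B], their union [X] is one of the two, yet both differ from [X]. *)
rewrite eMB in eMC; have [/setUidPl|/setUidPr] := cmp _ FC sCX; rewrite eMC => eXY.
  by rewrite eXY eqxx in neBX.
by rewrite eXY eqxx in neCX.
Qed.

End OneDense.

End ClosureRoots.

Theorem theorem5 (n : nat) (F : {set {set 'I_n}}) :
  union_closed F -> one_dense F ->
  (exists H : {set {set 'I_n}}, closure_root H F) <->
  uc_closure (rel_generated F (minimal_members F)) = F.
Proof.
move=> ucF dF; split=> [[H rootH]|eF].
  apply/eqP; rewrite eqEsubset sub_closure_rel_generated // andbT.
  exact: closure_rel_generated_sub rootH.
exists (rel_generated F (minimal_members F)); split=> //.
exact: union_closed_rel_generated.
Qed.
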